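(* For every scenario $(\Sigma,O)$, the simplicial complex map $f_{(\Sigma,O)}:\mathcal{E}_O\Sigma\to\Sigma$ is a bundle scenario.
   Context: A simplicial complex $\Sigma$ has a vertex set $\Sigma_0$ and a set of simplices (also written $\Sigma$) that are finite subsets of $\Sigma_0$, closed under taking (nonempty) subsets and containing all singletons. A map $f:\Gamma\to\Sigma$ is a function $\Gamma_0\to\Sigma_0$ with $f(\gamma)=\{f(x):x\in\gamma\}\in\Sigma$ for all $\gamma\in\Gamma$. The star of $\sigma\in\Sigma$ is $\mathrm{St}(\sigma)=\{\sigma'\in\Sigma:\sigma\subset\sigma'\}$. A bundle scenario is a map $f:\Gamma\to\Sigma$ of simplicial complexes that is: surjective (as a function between the sets of simplices); locally surjective, i.e. $f:\mathrm{St}(\gamma)\to\mathrm{St}(f(\gamma))$ is surjective for all $\gamma\in\Gamma$; and discrete over vertices, i.e. $\{x,y\}\notin\Gamma$ for all distinct $x,y\in\Gamma_0$ with $f(x)=f(y)$. A scenario $(\Sigma,O)$ is a simplicial complex $\Sigma$ together with a family $O=\{O_x\}_{x\in\Sigma_0}$ of nonempty sets. $\mathcal{E}_O\Sigma$ is the simplicial complex with vertex set $\bigsqcup_{x\in\Sigma_0}O_x$ (pairs $(x,o)$ with $o\in O_x$) and simplices the pairs $(\sigma,s)$ with $\sigma\in\Sigma$ and $s\in\prod_{x\in\sigma}O_x$, each regarded as the set of vertices $\{(x,s(x)):x\in\sigma\}$. The map $f_{(\Sigma,O)}$ is the projection $(\sigma,s)\mapsto\sigma$. *)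

(* Defs.v *)
From mathcomp Require Import all_boot all_classical.

Set Implicit Arguments.
Unset Strict Implicit.
Unset Printing Implicit Defensive.

Local Open Scope classical_set_scope.

(* Vertex sets are arbitrary, possibly infinite, types. The empty set is never
   a simplex. *)
Record simplicial_complex := SimplicialComplex {
  vertex :> Type;
  simplices : set (set vertex);
  simplex_finite : forall sigma, simplices sigma -> finite_set sigma;
  simplex_neq0 : forall sigma, simplices sigma -> sigma !=set0;
  simplex_sub : forall sigma tau, simplices sigma ->
    tau `<=` sigma -> tau !=set0 -> simplices tau;
  simplex_set1 : forall x, simplices [set x]
}.

Record simplicial_map (Gamma Sigma : simplicial_complex) := SimplicialMap {
  on_vertices :> Gamma -> Sigma;
  simplex_image : forall gamma,
    simplices gamma -> simplices (on_vertices @` gamma)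
}.

Definition on_simplices (Gamma Sigma : simplicial_complex)
    (f : simplicial_map Gamma Sigma) : set Gamma -> set Sigma :=
  fun gamma => f @` gamma.

Definition star (Sigma : simplicial_complex) (sigma : set Sigma) :
    set (set Sigma) :=
  [set sigma' | simplices sigma' /\ sigma `<=` sigma'].

Definition surjective (Gamma Sigma : simplicial_complex)
    (f : simplicial_map Gamma Sigma) : Prop :=
  set_surj (@simplices Gamma) (@simplices Sigma) (on_simplices f).

Definition locally_surjective (Gamma Sigma : simplicial_complex)
    (f : simplicial_map Gamma Sigma) : Prop :=
  forall gamma, simplices gamma ->
    set_surj (star gamma) (star (on_simplices f gamma)) (on_simplices f).

Definition discrete_over_vertices (Gamma Sigma : simplicial_complex)
    (f : simplicial_map Gamma Sigma) : Prop :=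
  forall x y : Gamma, x <> y -> f x = f y -> ~ simplices [set x; y].

Definition bundle_scenario (Gamma Sigma : simplicial_complex)
    (f : simplicial_map Gamma Sigma) : Prop :=
  [/\ surjective f, locally_surjective f & discrete_over_vertices f].

Record scenario := Scenario {
  measurements : simplicial_complex;
  outcomes : measurements -> Type;
  outcomes_inhabited : forall x, inhabited (outcomes x)
}.

Section EventComplex.
Variable S : scenario.
Let Sigma := measurements S.
Let O := @outcomes S.

Definition event : Type := {x : Sigma & O x}.

(* The set of vertices {(x, s x) : x in sigma} representing the pair
   (sigma, s); [s] is defined on the subtype of vertices in [sigma] only. *)
Definition event_graph (sigma : set Sigma) (s : forall x : sigma, O (val x)) :
    set event :=
  range (fun x : sigma => existT O (val x) (s x)).

Definition event_simplices : set (set event) :=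
  [set tau | exists (sigma : set Sigma) (s : forall x : sigma, O (val x)),
     simplices sigma /\ tau = event_graph s].

Lemma event_graph_proj (sigma : set Sigma) (s : forall x : sigma, O (val x)) :
  [set projT1 v | v in event_graph s] = sigma.
Proof.
apply/seteqP; split=> [_ [_ [x _ <-] <-]/=|x sx]; first exact: set_valP.
by exists (existT O x (s (SigSub (mem_set sx)))) => //; exists (SigSub (mem_set sx)).
Qed.

Lemma event_simplex_finite tau : event_simplices tau -> finite_set tau.
Proof.
move=> [sigma [s [hs ->]]]; apply: finite_image.
by rewrite (eq_finite_set (card_setT sigma)); exact: simplex_finite hs.
Qed.

Lemma event_simplex_neq0 tau : event_simplices tau -> tau !=set0.
Proof.
move=> [sigma [s [hs ->]]]; have [x sx] := simplex_neq0 hs.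
by eexists; exists (SigSub (mem_set sx)).
Qed.

Lemma event_simplex_sub sigma tau : event_simplices sigma ->
  tau `<=` sigma -> tau !=set0 -> event_simplices tau.
Proof.
move=> [sigma' [s [hs ->]]] sub [v tv].
pose rho : set Sigma := [set projT1 v | v in tau].
have sub' : rho `<=` sigma'.
  by rewrite -(event_graph_proj s); exact: image_subset.
pose incl (x : rho) : sigma' := SigSub (mem_set (sub' _ (set_valP x))).
exists rho, (fun x => s (incl x)); split.
  by apply: (simplex_sub hs sub'); exists (projT1 v), v.
apply/seteqP; split=> [w tw|_ [x _ <-]].
  have [y _ ew] := sub _ tw.
  have rw : rho (val y) by exists w => //; rewrite -ew.
  exists (SigSub (mem_set rw)) => //; rewrite -ew.
  apply: (congr1 (fun z : sigma' => existT O (val z) (s z))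
            (x := incl (SigSub (mem_set rw)))).
  exact: val_inj.
have [w tw wx] := set_valP x.
have [y _ ew] := sub _ tw.
suff xy : incl x = y.
  have := congr1 (fun z : sigma' => existT O (val z) (s z)) xy.
  by rewrite /= ew => ->.
by apply: val_inj => /=; rewrite -wx -ew.
Qed.

Lemma event_simplex_set1 v : event_simplices [set v].
Proof.
case: v => x o.
have e (y : [set x]) : x = val y by rewrite (set_valP y).
exists [set x], (fun y => eq_rect x O o (val y) (e y)); split.
  exact: simplex_set1.
have E (y : [set x]) :
    existT O (val y) (eq_rect x O o (val y) (e y)) = existT O x o.
  by case: _ / (e y).
apply/seteqP; split=> [_ ->|_ [y _ <-]]; last by rewrite E.
by exists (SigSub (mem_set (erefl x : [set x] x))); last exact: E.
Qed.

Definition event_complex : simplicial_complex :=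
  SimplicialComplex event_simplex_finite event_simplex_neq0
    event_simplex_sub event_simplex_set1.

Lemma event_proj_image (tau : set event_complex) : simplices tau ->
  simplices [set (projT1 v : Sigma) | v in tau].
Proof. by move=> [sigma [s [hs ->]]]; rewrite event_graph_proj. Qed.

(* On vertices (x, o) |-> x; hence (sigma, s) |-> sigma on simplices. *)
Definition scenario_map : simplicial_map event_complex Sigma :=
  @SimplicialMap event_complex Sigma (@projT1 Sigma O) event_proj_image.

Lemma scenario_mapE (sigma : set Sigma) (s : forall x : sigma, O (val x)) :
  on_simplices scenario_map (event_graph s) = sigma.
Proof. exact: event_graph_proj. Qed.

End EventComplex.

(* Main.v *)
Require Import Defs.
From mathcomp Require Import all_boot all_classical.

Set Implicit Arguments.
Unset Strict Implicit.
Unset Printing Implicit Defensive.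

Local Open Scope classical_set_scope.

(** Simplices over [sigma] are the sections of the outcomes over [sigma]. A global section restricts
    to every simplex, giving surjectivity; it also fills in the values missing from a partial
    section ([event_graph_extend]), giving local surjectivity. The graph of a function has one point
    over each vertex, hence discreteness. *)

Lemma global_section_exists (S : scenario) :
  inhabited (forall x : measurements S, outcomes x).
Proof.
(* The axiom of choice enters here, through [cid]. *)
have wit (x : measurements S) : {o : outcomes x | True}.
  by apply: cid; case: (outcomes_inhabited x) => o; exists o.
by constructor=> x; case: (wit x).
Qed.

Lemma event_graph_extend (S : scenario) (sigma sigma' : set (measurements S))
    (s : forall x : sigma, outcomes (val x)) : sigma `<=` sigma' ->
  exists s' : forall x : sigma', outcomes (val x),
    event_graph s `<=` event_graph s'.
Proof.
move=> sub; have [d] := global_section_exists S.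
exists (fun x : sigma' => if pselect (sigma (val x)) is left sx
  then s (SigSub (mem_set sx)) else d (val x)) => _ [x _ <-].
exists (SigSub (mem_set (sub _ (set_valP x)))) => //=.
case: pselect => [sx|/(_ (set_valP x))//].
(* The membership proof [sx] may differ from the one inside [x]. Comparing whole pairs as images of
   points of [sigma] avoids a transport between outcome types. *)
apply: (congr1 (fun z : sigma => existT (@outcomes S) (val z) (s z))
          (x := SigSub (mem_set sx))).
exact: val_inj.
Qed.

Theorem proposition3p2 (S : scenario) : bundle_scenario (scenario_map S).
Proof.
split.
- move=> sigma hs; have [d] := global_section_exists S.
  exists (event_graph (fun x : sigma => d (val x))); last exact: scenario_mapE.
  by exists sigma, (fun x : sigma => d (val x)).
- move=> _ [sigma [s [hs ->]]] sigma' [hs'].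
  rewrite scenario_mapE => /(event_graph_extend s)[s' ss'].
  exists (event_graph s'); last exact: scenario_mapE.
  by split=> //; exists sigma', s'.
- move=> x y xy fxy [sigma [s [_ e]]]; apply: xy.
  have [a _ ax] : event_graph s x by rewrite -e; left.
  have [b _ bY] : event_graph s y by rewrite -e; right.
  (* Both points of [sigma] lie under the same vertex, and [s] has a single value there. *)
  suff ab : a = b by rewrite -ax -bY ab.
  by apply: val_inj; move: fxy; rewrite -ax -bY.
Qed.
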